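(* Let $d\ge 2$ and $1\le k\le d$ be fixed, let $\varepsilon>0$, and let $\mathbf{p}_1,\dots,\mathbf{p}_n$ be independent points uniformly distributed in $[0,1]^d$. For an integer $j\ge 0$ let $L_{d,k}(n,j)$ be the number of points of $\{\mathbf{p}_1,\dots,\mathbf{p}_n\}$ that are $k$-dominated by exactly $j$ of the other points. Then, uniformly for integers $0\le j=o(n^{(1-\varepsilon)/d})$ (i.e. for every sequence of nonnegative integers $j=j(n)$ with $j(n)=o(n^{(1-\varepsilon)/d})$), as $n\to\infty$, \[ \mathbb{E}[L_{d,k}(n,j)]\to\begin{cases}0,& \text{if } 1\le k\le d-1,\\ \infty, & \text{if } k=d.\end{cases} \]
   Context: For points $\mathbf{p}=(p_1,\dots,p_d)$, $\mathbf{q}=(q_1,\dots,q_d)$ of $\mathbb{R}^d$, $\mathbf{p}$ $k$-dominates $\mathbf{q}$ if there is a set $S$ of $k$ coordinates such that $p_j\le q_j$ for all $j\in S$ and $p_j<q_j$ for at least one $j\in S$. *)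

(* Defs.v *)
From HB Require Import structures.
From mathcomp Require Import all_boot all_order all_algebra.
From mathcomp Require Import all_classical all_reals all_analysis.

Set Implicit Arguments.
Unset Strict Implicit.
Unset Printing Implicit Defensive.
Import Order.TTheory GRing.Theory Num.Theory.
Import numFieldNormedType.Exports.
Local Open Scope classical_set_scope.
Local Open Scope ring_scope.

(* R^d with the product of the Borel sigma-algebras. *)
Notation vec R d := (d.-tuple (measurableTypeR R)).

Definition kdominates (R : realType) (d k : nat) (p q : vec R d) : bool :=
  [exists S : {set 'I_d},
    [&& #|S| == k,
        [forall i in S, tnth p i <= tnth q i] &
        [exists i in S, tnth p i < tnth q i]]].

Definition num_kdominators (R : realType) (d k n : nat)
    (p : 'I_n -> vec R d) (i : 'I_n) : nat :=
  #|[pred m : 'I_n | (m != i) && kdominates k (p m) (p i)]|.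

Definition num_kdominated_by (R : realType) (d k n : nat)
    (p : 'I_n -> vec R d) (j : nat) : nat :=
  #|[pred i : 'I_n | num_kdominators k p i == j]|.

Section uniform_cube.
Variable R : realType.

Definition cons_vec (d : nat) (xt : measurableTypeR R * vec R d) : vec R d.+1 :=
  [the d.+1.-tuple (measurableTypeR R) of xt.1 :: xt.2].

Lemma measurable_cons_vec (d : nat) :
  measurable_fun [set: measurableTypeR R * vec R d] (@cons_vec d).
Proof. by apply: measurable_cons. Qed.

HB.instance Definition _ (d : nat) :=
  isMeasurableFun.Build _ _ _ _ (@cons_vec d) (@measurable_cons_vec d).

(* The uniform law on [0,1]^d, i.e. the d-fold product of the uniform law on
   [0,1]; cf. [uniform_cube_box]. *)
Fixpoint uniform_cube (d : nat) : probability (vec R d) R :=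
  match d with
  | 0 => \d_([tuple] : vec R 0)
  | d'.+1 =>
    distribution (uniform_prob (@ltr01 R) \x uniform_cube d')%E (@cons_vec d')
  end.

Lemma uniform_cube_box (d : nat) (A : 'I_d -> set (measurableTypeR R)) :
  (forall i, measurable (A i)) ->
  uniform_cube d [set x | forall i, A i (tnth x i)] =
  (\prod_(i < d) uniform_prob (@ltr01 R) (A i))%E.
Proof.
elim: d A => [|d IH] A mA.
  by rewrite big_ord0 /= diracE mem_set// => -[].
rewrite big_ord_recl -IH; last by move=> i; exact: mA.
rewrite /= /distribution /pushforward.
rewrite (_ : _ @^-1` _ =
  A ord0 `*` [set x : vec R d | forall i, A (lift ord0 i) (tnth x i)]).
  rewrite product_measure1E//.
  rewrite (_ : [set _ | _] =
    \big[setI/setT]_(i < d) ((fun x : vec R d => tnth x i) @^-1` A (lift ord0 i))).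
    apply: bigsetI_measurable => i _.
    by rewrite -[_ @^-1` _]setTI; exact: measurable_tnth.
  rewrite -bigcap_seq; apply/seteqP; split => x /= h i; first by move=> _; exact: h.
  by apply: h; rewrite /= mem_index_enum.
apply/seteqP; split => -[x t] /=.
  move=> h; split; first exact: (h ord0).
  by move=> i; have := h (lift ord0 i); rewrite /cons_vec/= tnthS.
move=> [h0 h] i; have [->|i0] := eqVneq i ord0; first exact: h0.
case: (unliftP ord0 i) i0 => [j -> _|->]; last by rewrite eqxx.
by rewrite /cons_vec/= tnthS; exact: h.
Qed.

End uniform_cube.

Definition uniform_on_cube (disp : measure_display) (T : measurableType disp)
    (R : realType) (P : probability T R) (d : nat)
    (X : {RV P >-> vec R d}) : Prop :=
  forall B : set (vec R d), measurable B ->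
    distribution P X B = uniform_cube R d B.

Definition mutually_independent (disp disp' : measure_display)
    (T : measurableType disp) (T' : measurableType disp') (R : realType)
    (P : probability T R) (I : finType) (X : I -> {RV P >-> T'}) : Prop :=
  forall (J : {set I}) (B : I -> set T'),
    (forall i, i \in J -> measurable (B i)) ->
    P [set w | forall i, i \in J -> B i (X i w)] =
    (\prod_(i in J) P (X i @^-1` B i))%E.

(* Main.v *)
Require Import Defs.
From HB Require Import structures.
From mathcomp Require Import all_boot all_order all_algebra.
From mathcomp Require Import all_classical all_reals all_analysis.
From mathcomp Require Import measurable_realfun.
From mathcomp Require Import ring lra zify.

Set Implicit Arguments.
Unset Strict Implicit.
Unset Printing Implicit Defensive.
Import Order.TTheory GRing.Theory Num.Theory.
Import numFieldNormedType.Exports.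
Local Open Scope classical_set_scope.
Local Open Scope ring_scope.

(** Conditionally on its position [x], a point is dominated by a binomial number
    of the other [n - 1] points, with success probability [F x], the volume of
    the set of points dominating [x]; hence the expectation is
    [n C(n-1, j) \int F^j (1 - F)^(n-1-j)].

    For [k < d], [F x] is at least every product of [d - 1] coordinates, so that
    [F^d >= (x_1 ... x_d)^(d-1)].  The binomial probability is at most
    [((j + 2) / (n F))^b] for every [b] in [[0, 2]], and [\int F^(-b)] is finite
    as soon as [b < d / (d - 1)]; then [n ((j + 2) / n)^b] tends to [0] for [b]
    close enough to [d / (d - 1)].

    For [k = d], [F x = x_1 ... x_d].  Integrating over [x_1] only, with [c] the
    product of the other coordinates, gives [1 / c] times the probability that a
    beta variable of mean [(j + 1) / (n + 1)] is at most [c]; this tends to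
    [1 / c], whose integral diverges because [d >= 2]. *)

(** * Independence and the expected number of points of given indegree *)

(** As [X i] is independent of the family of all the other variables, the joint law is a product
    measure and Tonelli applies: once [X i] is fixed at [x], the event is an intersection of
    independent events, one for each [m != i]. *)
Lemma mutually_independent_fibers (disp disp' : measure_display)
    (T : measurableType disp) (V : measurableType disp') (R : realType)
    (P : probability T R) (I : finType) (X : I -> {RV P >-> V}) (i : I)
    (E : I -> set (V * V)) :
  mutually_independent X -> (forall m, measurable (E m)) ->
  P [set w | forall m, m != i -> E m (X i w, X m w)] =
  (\int[distribution P (X i)]_x
    \prod_(m | m != i) distribution P (X m) (xsection (E m) x))%E.
Proof.
move=> indX mE.
pose box (B : I -> set V) := [set w | forall m, m != i -> B m (X m w)].
pose G : set (set T) :=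
  [set A | exists2 B, (forall m, measurable (B m)) & A = box B].
have boxE B : box B = [set w | forall m, m \in [set~ i]%SET -> B m (X m w)].
  apply/seteqP; split => w /= h m; rewrite ?inE => mi; apply: h => //.
  by rewrite !inE.
have mX m (B : set V) : measurable B -> measurable (X m @^-1` B).
  by move=> mB; rewrite -[_ @^-1` _]setTI; exact: measurable_funP.
have mbox B : (forall m, measurable (B m)) -> measurable (box B).
  move=> mB; rewrite (_ : box B =
     \bigcap_(m in [set m | m != i]) (X m @^-1` B m)); last first.
    by apply/seteqP; split => w h m; exact: h.
  by apply: fin_bigcap_measurable => [|m _]; [exact: finite_finset|exact: mX].
have GI : setI_closed G.
  move=> _ _ [B mB ->] [C mC ->]; exists (fun m => B m `&` C m).
    by move=> m; exact: measurableI.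
  apply/seteqP; split => [w [/= h1 h2] m mi|w /= h].
    by split; [exact: h1|exact: h2].
  by split => m /h [].
have GT : G setT by exists (fun=> setT) => //; apply/esym/seteqP; split.
have Gm : G `<=` measurable by move=> _ [B mB ->]; exact: mbox.
(* [W] is [T] with the sigma-algebra generated by the other variables; under
   [w |-> (X i w, w)] the law of [T] becomes a product measure on [V * W], and
   the sections of the event in question are again boxes. *)
pose W : measurableType _ := g_sigma_algebraType G.
have sGm (B : set W) : measurable B -> (measurable : set (set T)) B.
  exact: (smallest_sub (@sigma_algebra_measurable _ T) Gm).
have mid : measurable_fun [set: T] (id : T -> W).
  by move=> _ B mB; rewrite setTI preimage_id; exact: sGm.
(* A condition on [X m] alone is a box whose other sides are the whole space. *)
have mXW m : m != i -> measurable_fun [set: W] (X m : W -> V).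
  move=> mi _ B mB; rewrite setTI; apply: sub_sigma_algebra.
  exists (fun m' => if m' == m then B else setT).
    by move=> m'; case: ifP.
  apply/seteqP; split => [w /= h m' _|w /(_ _ mi)]; last by rewrite eqxx.
  by case: eqP => // ->.
pose idW : {mfun T >-> W} := HB.pack (id : T -> W)
  (isMeasurableFun.Build _ _ _ _ (id : T -> W) mid).
pose Q : probability W R := distribution P idW.
have mf : measurable_fun [set: T] (fun w => (X i w, w : W)).
  by apply: measurable_fun_pair => //; exact: measurable_funP.
pose f : {mfun T >-> (V * W)%type} := HB.pack (fun w : T => (X i w, w : W))
  (isMeasurableFun.Build _ _ _ _ (fun w : T => (X i w, w : W)) mf).
have Pbox B : (forall m, measurable (B m)) ->
    P (box B) = (\prod_(m | m != i) P (X m @^-1` B m))%E.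
  move=> mB; rewrite boxE indX//; by apply: eq_bigl => m; rewrite !inE.
have fE A (B : set W) : measurable A -> measurable B ->
    distribution P f (A `*` B) = (distribution P (X i) A * Q B)%E.
  move=> mA mB.
  have mXA := mX i A mA.
  have [r r0 Pr] : exists2 r : R, 0 <= r & P (X i @^-1` A) = r%:E.
    exists (fine (P (X i @^-1` A))); first exact: fine_ge0.
    by rewrite fineK//; exact: fin_num_measure.
  have cov : \bigcup_(k : nat) [set: T] = setT.
    by apply/seteqP; split => // w _; exists 0%N.
  rewrite [LHS](_ : _ = P (B `&` X i @^-1` A)); last by rewrite setIC.
  (* As functions of [B] both sides are measures: the restriction of [P] to the preimage of [A], and
     [P] scaled by the number [r]. They agree on [G], which is stable under intersection and
     contains the whole space, hence on the sigma-algebra it generates. *)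
  rewrite [distribution P (X i) A]Pr.
  change (mrestr P mXA B = mscale (NngNum r0) P B).
  apply: (@g_sigma_algebra_measure_unique _ R T G Gm (fun=> setT)) => //.
  - move=> _ [C mC ->]; 
    change (P (box C `&` X i @^-1` A) = (r%:E * P (box C))%E).
    rewrite -Pr Pbox//.
    (* Independence of the whole family, with [A] as the constraint at index [i]. *)
    have := indX [set: I]%SET (fun m => if m == i then A else C m).
    rewrite (_ : [set w | _] = box C `&` X i @^-1` A).
      move=> ->; last by move=> m _; case: ifP.
      rewrite (bigD1 i)//= ?inE// eqxx; congr (_ * _)%E.
      apply: eq_big => [m|m mi]; first by rewrite inE.
      by rewrite ifN//; rewrite inE in mi.
    apply/seteqP; split => [w /= h|w [/= h1 h2] m _].
      split => [m mi|]; first by have := h m; rewrite inE (negbTE mi); apply.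
      by have := h i; rewrite inE eqxx; apply.
    by have [->//|/h1] := eqVneq m i.
  - move=> _; change (P (setT `&` X i @^-1` A) < +oo)%E.
    by rewrite setTI Pr ltry.
pose S := [set z : V * W | forall m, m != i -> E m (z.1, X m z.2)].
have mS : measurable S.
  rewrite (_ : S = \bigcap_(m in [set m | m != i])
      ((fun z : V * W => (z.1, X m z.2)) @^-1` E m)); last first.
    by apply/seteqP; split => w h m; exact: h.
  apply: fin_bigcap_measurable => [|m /= mi]; first exact: finite_finset.
  rewrite -[_ @^-1` _]setTI.
  suff : measurable_fun setT (fun z : V * W => (z.1, X m z.2)) by exact.
  apply: measurable_fun_pair => //.
  by apply: measurableT_comp => //; exact: mXW.
rewrite [LHS](_ : _ = distribution P f S)//.
rewrite -(@product_measure_unique _ _ _ _ _ (distribution P (X i)) Q _ fE)//.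
rewrite /product_measure1/=; apply: eq_integral => x _ /=.
rewrite (_ : xsection S x = box (fun m => xsection (E m) x)); last first.
  apply/seteqP; split => w.
    by move=> /xsectionP h m mi; apply/xsectionP; exact: h.
  by move=> h; apply/xsectionP => m mi; apply/xsectionP; exact: h.
rewrite /distribution /pushforward /= preimage_id Pbox//.
by move=> m; exact: measurable_xsection.
Qed.

(** For a fixed [i], exactly one set avoiding [i] is the in-neighbourhood, so the sum over the sets
    of size [j] is [1] or [0] according to the indegree. Each summand prescribes [r m i] for every
    [m != i], an event to which [mutually_independent_fibers] applies. *)
Lemma card_exact_indegree (R : pzSemiRingType) (I : finType) (r : rel I) (j : nat) :
  #|[pred i | #|[pred m | (m != i) && r m i]| == j]|%:R =
  \sum_(z : I * {set I} | (z.1 \notin z.2) && (#|z.2| == j))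
    [forall m, (m != z.1) ==> (r m z.1 == (m \in z.2))]%:R :> R.
Proof.
rewrite -sum1_card natr_sum -(pair_big_dep xpredT
  (fun i (S : {set I}) => (i \notin S) && (#|S| == j))
  (fun i (S : {set I}) => [forall m, (m != i) ==> (r m i == (m \in S))]%:R))/=.
rewrite [LHS]big_mkcond/=; apply: eq_bigr => i _.
pose S0 := [set m | (m != i) && r m i]%SET.
have S0P (S : {set I}) : i \notin S ->
    [forall m, (m != i) ==> (r m i == (m \in S))] = (S == S0).
  move=> iS; apply/forallP/eqP => [h|-> m].
    apply/setP => m; rewrite inE; have := h m.
    by have [->/=|_ /= /eqP->] := eqVneq m i; first by rewrite (negbTE iS).
  by apply/implyP => mi; rewrite inE mi.
rewrite inE (_ : #|[pred m | _]| = #|S0|); last first.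
  by apply: eq_card => m; rewrite !inE.
case: eqVneq => [S0j|S0j].
  rewrite (bigD1 S0)/=; last by rewrite !inE eqxx S0j eqxx.
  rewrite S0P ?inE ?eqxx// big1 ?addr0// => S /andP[/andP[iS _] /negbTE SS0].
  by rewrite S0P// SS0.
rewrite big1// => S /andP[iS /eqP Sj]; rewrite S0P//.
by have [SS0|//] := eqVneq S S0; rewrite -SS0 Sj eqxx in S0j.
Qed.

Definition domination_prob (disp : measure_display) (V : measurableType disp)
  (R : realType) (mu : probability V R) (r : rel V) (x : V) : R :=
  fine (mu [set y | r y x]).

(** The event that the in-neighbourhood of [i] is a given [S] of size [j] has probability
    [\int F^j (1 - F)^(#|I| - 1 - j)], the same for all pairs [(i, S)]; the factor in front counts
    the pairs. *)
Lemma expected_exact_indegree (disp disp' : measure_display)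
    (T : measurableType disp) (V : measurableType disp') (R : realType)
    (P : probability T R) (mu : probability V R) (I : finType)
    (X : I -> {RV P >-> V}) (r : rel V) (j : nat) :
  mutually_independent X ->
  (forall i B, measurable B -> distribution P (X i) B = mu B) ->
  measurable [set z : V * V | r z.2 z.1] ->
  ('E_P[fun w => #|[pred i | #|[pred m |
     (m != i) && r (X m w) (X i w)]| == j]|%:R] =
   (#|I| * 'C(#|I|.-1, j))%:R%:E *
   \int[mu]_x ((domination_prob mu r x) ^+ j *
     (1 - domination_prob mu r x) ^+ (#|I|.-1 - j))%:E)%E.
Proof.
move=> indX lawX mr.
pose E (S : {set I}) m := [set z : V * V | r z.2 z.1 = (m \in S)].
have mE S m : measurable (E S m).
  rewrite /E; case: (m \in S) => //.
  rewrite (_ : [set z | _] = ~` [set z : V * V | r z.2 z.1]).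
    exact: measurableC.
  by apply/seteqP; split => z /=; case: (r _ _).
pose A (z : I * {set I}) :=
  [set w | forall m, m != z.1 -> E z.2 m (X z.1 w, X m w)].
have mA z : measurable (A z).
  rewrite (_ : A z = \bigcap_(m in [set m | m != z.1])
      ((fun w => (X z.1 w, X m w)) @^-1` E z.2 m)); last first.
    by apply/seteqP; split => w h m; exact: h.
  apply: fin_bigcap_measurable => [|m /= _]; first exact: finite_finset.
  rewrite -[_ @^-1` _]setTI.
  suff : measurable_fun setT (fun w => (X z.1 w, X m w)).
    by move=> /(_ measurableT); exact.
  by apply: measurable_fun_pair; exact: measurable_funP.
pose s := [seq z : I * {set I} <- index_enum _ |
  (z.1 \notin z.2) && (#|z.2| == j)].
rewrite unlock.
rewrite (eq_integral (fun w => \sum_(z <- s) (\1_(A z) w)%:E)%E); last first.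
  move=> w _; rewrite (card_exact_indegree R (fun m i => r (X m w) (X i w))).
  rewrite big_filter sumEFin; congr EFin; apply: eq_bigr => z _.
  rewrite indicE; congr (_ %:R); congr nat_of_bool.
  apply/forallP/idP => [h|].
    by rewrite inE => m mz; have := h m; rewrite mz/= => /eqP.
  by rewrite inE => h m; apply/implyP => mz; apply/eqP; exact: h.
rewrite ge0_integral_sum//; last first.
  by move=> z; apply/measurable_EFinP; exact: measurable_indic.
set F := domination_prob mu r.
have FE S m x : mu (xsection (E S m) x) =
    (if m \in S then F x else 1 - F x)%:E.
  rewrite /F /domination_prob; set B := [set y | r y x].
  have mB : measurable B.
    rewrite (_ : B = xsection [set z : V * V | r z.2 z.1] x).
      exact: measurable_xsection.
    by apply/seteqP; split => y; rewrite xsectionP.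
  rewrite (_ : xsection _ _ = if m \in S then B else ~` B); last first.
    apply/seteqP; split => y; rewrite xsectionP /E/=; case: (m \in S) => //.
    - by move=> ry; rewrite /B/= ry.
    - by rewrite /B/= => /negP/negbTE.
  case: ifP => _; first by rewrite fineK// fin_num_measure.
  by rewrite probability_setC// EFinB fineK// fin_num_measure.
transitivity (\sum_(z <- s) \int[mu]_x (F x ^+ j *
    (1 - F x) ^+ (#|I|.-1 - j))%:E)%E.
  rewrite [LHS]big_filter [RHS]big_filter.
  apply: eq_bigr => -[i S] /andP[/= iS /eqP Sj].
  rewrite integral_indic// setIT.
  apply: etrans (mutually_independent_fibers i indX (mE S)) _.
  rewrite (eq_measure_integral mu); last by move=> B mB _; exact: lawX.
  apply: eq_integral => x _.
  under eq_bigr => m _.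
    rewrite lawX ?FE; last exact: measurable_xsection.
    over.
  rewrite prodEFin; congr EFin.
  rewrite (bigID (mem S))/=; congr (_ * _).
    rewrite (eq_bigr (fun=> F x)); last by move=> m /andP[_ ->].
    rewrite prodr_const; congr (_ ^+ _); rewrite -Sj; apply: eq_card => m.
    rewrite unfold_in/=; have [->/=|//] := eqVneq m i.
    by rewrite (negbTE iS).
  rewrite (eq_bigr (fun=> 1 - F x)); last by move=> m /andP[_ /negbTE->].
  rewrite prodr_const; congr (_ ^+ _).
  (* The factors [1 - F x] come from the indices outside [S] other than [i]; as [i] is not in [S],
     there are [#|I| - 1 - j] of them. *)
  rewrite (_ : #|_| = #|~: (i |: S)|); last first.
    by apply: eq_card => m; rewrite unfold_in/= !inE negb_or.
  have := cardsC (i |: S); rewrite cardsU1 iS Sj => <-; lia.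
rewrite [LHS]big_filter sumr_const mule_natl; congr (_ *+ _)%E.
rewrite -sum1_card -(pair_big_dep xpredT
  (fun i (S : {set I}) => (i \notin S) && (#|S| == j)) (fun _ _ => 1%N))/=.
rewrite -sum_nat_const; apply: eq_bigr => i _.
(* The sets avoiding [i] are the subsets of a set with [#|I| - 1] elements. *)
rewrite sum1_card -(cardsC1 i) -cards_draws; apply: eq_card => S.
by rewrite !inE finset.subsetC finset.sub1set inE.
Qed.

(** * The uniform law: Tonelli, intervals, measurability *)

(** Tonelli for the recursive definition of [uniform_cube]. The first coordinate is the inner
    variable, the order in which [x_1] is integrated out when [k = d]. *)
Lemma ge0_integral_uniform_cubeS (R : realType) (d : nat)
    (f : vec R d.+1 -> \bar R) :
  measurable_fun setT f -> (forall x, 0 <= f x)%E ->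
  (\int[uniform_cube R d.+1]_x f x =
   \int[uniform_cube R d]_t
     \int[uniform_prob (@ltr01 R)]_u f (cons_vec (u, t)))%E.
Proof.
move=> mf f0.
rewrite [LHS](ge0_integral_distribution (@cons_vec R d))//.
rewrite fubini_tonelli2//=.
by apply: measurableT_comp => //; exact: measurable_cons_vec.
Qed.

Lemma uniform_prob_itv (R : realType) (l r : bool) (a b : R) :
  0 <= a -> a <= b -> b <= 1 ->
  uniform_prob (@ltr01 R) [set` Interval (BSide l a) (BSide r b)] = (b - a)%:E.
Proof.
move=> a0 ab b1; rewrite /uniform_prob.
rewrite (eq_integral (fun=> 1%:E)); last first.
  move=> x; rewrite inE/= => xab.
  rewrite /uniform_pdf subr0 invr1.
  suff -> : 0 <= x <= 1 by [].
  move: xab; rewrite itv_boundlr => /andP[].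
  case: l; case: r => /=; rewrite !bnd_simp; lra.
rewrite integral_cst//= mul1e lebesgue_measure_itv/= lte_fin.
by case: ltP => [|ba]; rewrite ?EFinB//; congr EFin; lra.
Qed.

Lemma uniform_prob_itvNy (R : realType) (r : bool) (b : R) : 0 <= b <= 1 ->
  uniform_prob (@ltr01 R) [set` Interval -oo%O (BSide r b)] = b%:E.
Proof.
move=> /andP[b0 b1].
rewrite /uniform_prob integral_uniform_pdf -[in RHS](subr0 b).
rewrite -(@uniform_prob_itv R true r 0 b)// /uniform_prob.
congr (integral _ _ _); apply/seteqP; split => x /=.
  by case: r => -[]; rewrite !in_itv/= => h1 /andP[h2 _]; rewrite h2.
by case: r; rewrite !in_itv/= => /andP[h1 h2]; split => //; lra.
Qed.

Lemma measurable_kdominates (R : realType) (d k : nat) :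
  measurable [set z : vec R d * vec R d | kdominates k z.2 z.1].
Proof.
have m1 i : measurable_fun setT (fun z : vec R d * vec R d => tnth z.1 i : R).
  exact: (measurableT_comp (measurable_tnth i) measurable_fst).
have m2 i : measurable_fun setT (fun z : vec R d * vec R d => tnth z.2 i : R).
  exact: (measurableT_comp (measurable_tnth i) measurable_snd).
rewrite (_ : [set z | _] = \bigcup_(S in [set S : {set 'I_d} | #|S| = k])
  (\bigcap_(i in [set i | i \in S]) [set z | tnth z.2 i <= tnth z.1 i] `&`
   \bigcup_(i in [set i | i \in S]) [set z | tnth z.2 i < tnth z.1 i])).
  apply: fin_bigcup_measurable => [|S _]; first exact: finite_finset.
  apply: measurableI.
    apply: fin_bigcap_measurable => [|i _]; first exact: finite_finset.
    rewrite -[X in measurable X]setTI.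
    by have /(_ measurableT [set true]) := measurable_fun_ler (m2 i) (m1 i); exact.
  apply: fin_bigcup_measurable => [|i _]; first exact: finite_finset.
  rewrite -[X in measurable X]setTI.
  by have /(_ measurableT [set true]) := measurable_fun_ltr (m2 i) (m1 i); exact.
apply/seteqP; split => z /=.
  move=> /existsP[S /and3P[/eqP Sk /forall_inP h1 /exists_inP[i iS h2]]].
  by exists S => //; split => [i' i'S|]; [exact: h1|exists i].
move=> [S /= Sk [h1 [i /= iS h2]]]; apply/existsP; exists S; apply/and3P; split.
- exact/eqP.
- by apply/forall_inP => i' i'S; exact: h1.
- by apply/exists_inP; exists i.
Qed.

Lemma measurable_box (R : realType) (d : nat) (A : 'I_d -> set (measurableTypeR R)) :
  (forall i, measurable (A i)) ->
  measurable [set x : vec R d | forall i, A i (tnth x i)].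
Proof.
move=> mA; rewrite (_ : [set _ | _] =
    \bigcap_(i in [set: 'I_d]) ((fun x : vec R d => tnth x i) @^-1` A i)).
  apply: fin_bigcap_measurable => [|i _]; first exact: finite_finset.
  by rewrite -[_ @^-1` _]setTI; exact: measurable_tnth.
by apply/seteqP; split => x h i; [move=> _; exact: h|exact: h].
Qed.

(** * The probability that a uniform point [k]-dominates a fixed one *)

Local Notation coord_prod x := (\prod_i tnth x i).

Local Notation kdom_prob R d k :=
  (domination_prob (uniform_cube R d) (@kdominates R d k)).

Lemma measurable_kdominated (R : realType) (d k : nat) (x : vec R d) :
  measurable [set y | kdominates k y x].
Proof.
rewrite (_ : [set y | _] = xsection [set z : vec R d * vec R d | kdominates k z.2 z.1] x).
  by apply: measurable_xsection; exact: measurable_kdominates.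
by apply/seteqP; split => y; rewrite xsectionP.
Qed.

Lemma measurable_kdom_prob (R : realType) (d k : nat) :
  measurable_fun setT (kdom_prob R d k).
Proof.
apply: measurableT_comp => //.
rewrite [X in measurable_fun _ X](_ : _ = uniform_cube R d \o
    xsection [set z : vec R d * vec R d | kdominates k z.2 z.1]).
  by apply: measurable_fun_xsection; exact: measurable_kdominates.
apply/funext => x /=; congr (uniform_cube R d _).
by apply/seteqP; split => y; rewrite xsectionP.
Qed.

Lemma kdom_prob_itv01 (R : realType) (d k : nat) (x : vec R d) :
  0 <= kdom_prob R d k x <= 1.
Proof.
rewrite fine_ge0//= -lee_fin fineK; last first.
  by rewrite fin_num_measure//; exact: measurable_kdominated.
by rewrite probability_le1//; exact: measurable_kdominated.
Qed.

(** A point strictly below [x] in every coordinate of [S] dominates [x], and such points form a box.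
    Strictness in at least one coordinate is where [0 < k] enters. *)
Lemma kdom_prob_ge (R : realType) (d k : nat) (x : vec R d) (S : {set 'I_d}) :
  (0 < k)%N -> #|S| = k -> (forall i, 0 <= tnth x i <= 1) ->
  \prod_(i in S) tnth x i <= kdom_prob R d k x.
Proof.
move=> k0 Sk x01.
(* The sides are unbounded below; only their part in [[0, 1]] has mass, so a side ending at
   [tnth x i] has probability [tnth x i]. *)
pose A i : set (measurableTypeR R) :=
  if i \in S then [set` `]-oo, tnth x i[ ] else setT.
have mA i : measurable (A i) by rewrite /A; case: ifP.
rewrite -lee_fin fineK; last first.
  by rewrite fin_num_measure//; exact: measurable_kdominated.
rewrite (_ : (\prod_(i in S) _)%:E =
    uniform_cube R d [set y | forall i, A i (tnth y i)]).
  apply: le_measure; rewrite ?inE; [exact: measurable_box|exact: measurable_kdominated|].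
  move=> y /= h; apply/existsP; exists S; rewrite Sk eqxx/=.
  have h' i : i \in S -> tnth y i < tnth x i.
    by move=> iS; have := h i; rewrite /A iS/= in_itv.
  apply/andP; split; first by apply/forall_inP => i /h' /ltW.
  have [i iS] : exists i, i \in S by apply/card_gt0P; rewrite Sk.
  by apply/exists_inP; exists i => //; exact: h'.
rewrite uniform_cube_box// -prodEFin [LHS]big_mkcond/=; apply: eq_bigr => i _.
rewrite /A; case: ifP => _; last by rewrite probability_setT.
by rewrite uniform_prob_itvNy.
Qed.

(** The lower bound is [kdom_prob_ge] for the set of all coordinates. Conversely, a dominating point
    lies in the closed box below [x], which has the same volume as the open one. *)
Lemma kdom_prob_full (R : realType) (d : nat) (x : vec R d) :
  (0 < d)%N -> (forall i, 0 <= tnth x i <= 1) ->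
  kdom_prob R d d x = coord_prod x.
Proof.
move=> d0 x01; apply/le_anti/andP; split; last first.
  rewrite (le_trans _ (@kdom_prob_ge R d d x [set: 'I_d]%SET _ _ _))//.
    by rewrite le_eqVlt; apply/orP; left; apply/eqP/eq_bigl => i; rewrite inE.
  by rewrite cardsT card_ord.
pose A i : set (measurableTypeR R) := [set` `]-oo, tnth x i] ].
have mA i : measurable (A i) by exact: measurable_itv.
rewrite -lee_fin fineK; last first.
  by rewrite fin_num_measure//; exact: measurable_kdominated.
rewrite (_ : (\prod_i _)%:E =
    uniform_cube R d [set y | forall i, A i (tnth y i)]).
  apply: le_measure; rewrite ?inE; [exact: measurable_kdominated|exact: measurable_box|].
  move=> y /= /existsP[S /and3P[/eqP Sk /forall_inP h _]] i.
  rewrite /A/= in_itv/=; apply: h.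
  suff -> : S = [set: 'I_d]%SET by rewrite inE.
  by apply/eqP; rewrite finset.eqEcard finset.subsetT cardsT card_ord Sk leqnn.
rewrite uniform_cube_box// -prodEFin; apply: eq_bigr => i _.
by rewrite /A uniform_prob_itvNy.
Qed.

(** * Integrals of negative powers and of products over the cube *)

(** The antiderivative is [u^(1 - a) / (1 - a)]. Since the integrand may blow up at [0], the
    fundamental theorem is applied on intervals away from [0], followed by monotone convergence. *)
Lemma integral_uniform_powRN (R : realType) (a : R) : 0 <= a < 1 ->
  (\int[uniform_prob (@ltr01 R)]_u (u `^ (- a))%:E <= ((1 - a)^-1)%:E)%E.
Proof.
move=> /andP[a0 a1].
have ge0 (u : R) : (0 <= (u `^ (- a))%:E)%E by rewrite lee_fin powR_ge0.
have mpow : measurable_fun setT (fun u : measurableTypeR R => (u `^ (- a))%:E).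
  by apply/measurable_EFinP; exact: measurable_powR.
rewrite integral_uniform// subr0 invr1 mul1e.
(* Starting at [1 / (n + 2)] keeps every interval nondegenerate, even for [n = 0]. *)
pose F n := [set` `[(n.+2%:R^-1 : R), 1] ].
have U : [set` `]0, 1] ] = \bigcup_n F n.
  apply/seteqP; split => u; rewrite /= in_itv/=.
    move=> /andP[u0 u1]; have [n _ nu] := near_infty_natSinv_lt (PosNum u0).
    exists n => //; rewrite /F/= in_itv/= u1 andbT ltW//.
    by rewrite (lt_trans _ (nu n _))//= ltf_pV2 ?posrE// ltr_nat.
  move=> [n _]; rewrite /F/= in_itv/= => /andP[nu ->]; rewrite andbT.
  by rewrite (lt_le_trans _ nu).
have -> : (\int[@lebesgue_measure R]_(u in `[0%R, 1%R]) (u `^ (- a))%:E =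
           \int[@lebesgue_measure R]_(u in \bigcup_n F n) (u `^ (- a))%:E)%E.
  rewrite -U integral_itv_obnd_cbnd//.
  exact: measurable_funTS mpow.
have mF n : measurable (F n) by exact: measurable_itv.
have ndF : nondecreasing_seq F.
  move=> m n mn; apply/subsetPset => u; rewrite /F/= !in_itv/= => /andP[mu1 ->].
  by rewrite andbT (le_trans _ mu1)// lef_pV2 ?posrE// ler_nat !ltnS.
have cv := @ge0_nondecreasing_set_cvg_integral _ (measurableTypeR R) R F
  (fun u => (u `^ (- a))%:E) (@lebesgue_measure R) ndF mF.
have FE n : (\int[@lebesgue_measure R]_(u in F n) (u `^ (- a))%:E <= ((1 - a)^-1)%:E)%E.
  have n1 : (n.+2%:R^-1 : R) < 1 by rewrite invf_lt1// ltr1n.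
  have n0 : 0 < (n.+2%:R^-1 : R) by rewrite invr_gt0.
  have dF (u : R) : 0 < u ->
      is_derive u 1 (fun v : R => (1 - a)^-1 * v `^ (1 - a)) (u `^ (- a)).
    move=> u0; have h := is_derive1_powR (1 - a) u0.
    have a1' : 1 - a != 0 by rewrite subr_eq0 gt_eqF.
    apply: (@is_derive_eq _ _ _ _ _ _ _ _ (is_deriveZ (1 - a)^-1 h)).
    by rewrite -mulr_algl/= mulrA scaler1 mulVf// mul1r; congr (_ `^ _); lra.
  rewrite (@continuous_FTC2 _ _ (fun v : R => (1 - a)^-1 * v `^ (1 - a)))//.
  - rewrite -EFinB lee_fin powR1 mulr1 gerBl mulr_ge0 ?powR_ge0// invr_ge0; lra.
  - apply: derivable_within_continuous => u.
    rewrite in_itv/= => /andP[nu _]; apply: derivable_powR.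
    by rewrite in_itv/= andbT (lt_le_trans n0 nu).
  - have cF (u : R) : 0 < u ->
        {for u, continuous (fun v : R => (1 - a)^-1 * v `^ (1 - a))}.
      by move=> /dF h; apply: differentiable_continuous; exact/derivable1_diffP.
    split.
    + move=> u; rewrite in_itv/= => /andP[nu _].
      by have [] := dF u (lt_trans n0 nu).
    + by apply: cvg_at_right_filter; exact: cF.
    + by apply: cvg_at_left_filter; exact: cF.
  - move=> u; rewrite in_itv/= => /andP[nu _].
    by rewrite derive1E; have [_ ->] := dF u (lt_trans n0 nu).
rewrite -(cvg_lim _ (cv _ _))//; last by move=> n; exact: measurable_funTS.
apply: lime_le; last by exact: nearW.
by apply/cvg_ex; eexists; apply: cv => // n; exact: measurable_funTS.
Qed.

(** The coordinates are independent, so the integral of the product factorises; Tonelli splits off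
    one coordinate at a time. *)
Lemma integral_uniform_cube_prod_le (R : realType) (h : R -> R) (C : R) (d : nat) :
  measurable_fun setT (h : measurableTypeR R -> measurableTypeR R) ->
  (forall u, 0 <= h u) ->
  (\int[uniform_prob (@ltr01 R)]_u (h u)%:E <= C%:E)%E ->
  (\int[uniform_cube R d]_x (\prod_i h (tnth x i))%:E <= (C ^+ d)%:E)%E.
Proof.
move=> mh h0 hC.
have C0 : 0 <= C.
  by rewrite -lee_fin (le_trans _ hC)// integral_ge0// => u _; rewrite lee_fin.
have ph0 n (x : vec R n) : 0 <= \prod_i h (tnth x i) by rewrite prodr_ge0.
have mph n : measurable_fun setT (fun x : vec R n => \prod_i h (tnth x i)).
  by apply: measurable_prod => i _; exact: (measurableT_comp mh (measurable_tnth i)).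
elim: d => [|d IH].
  rewrite (eq_integral (fun=> 1%:E)); last by move=> x _; rewrite big_ord0.
  by rewrite integral_cst// mul1e expr0 [leLHS]probability_setT.
rewrite ge0_integral_uniform_cubeS; first last.
- by move=> x; rewrite lee_fin.
- by apply/measurable_EFinP; exact: mph.
rewrite (eq_integral (fun t : vec R d =>
  (\int[uniform_prob (@ltr01 R)]_u (h u)%:E) * (\prod_i h (tnth t i))%:E)%E); last first.
  move=> t _; rewrite -ge0_integralZr//; first last.
  - by rewrite lee_fin.
  - by move=> u _; rewrite lee_fin.
  - by apply/measurable_EFinP; exact: mh.
  apply: eq_integral => u _; rewrite -EFinM big_ord_recl.
  by congr (_ * _)%:E; apply: eq_bigr => i _; rewrite /cons_vec/= tnthS.
rewrite ge0_integralZl//; first last.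
- by apply: integral_ge0 => u _; rewrite lee_fin.
- by move=> t _; rewrite lee_fin.
- by apply/measurable_EFinP; exact: mph.
rewrite exprS EFinM lee_pmul// integral_ge0// => u _; rewrite lee_fin//.
Qed.

(** Zero coordinates are excluded because products of coordinates get inverted and raised to
    negative powers. *)
Definition pos_cube (R : realType) (d : nat) : set (vec R d) :=
  [set x | forall i, [set` `]0, 1] ] (tnth x i)].

Lemma measurable_pos_cube (R : realType) (d : nat) : measurable (@pos_cube R d).
Proof.
by apply: (@measurable_box R d (fun=> [set` `]0, 1] ])) => i; exact: measurable_itv.
Qed.

Lemma uniform_cube_pos_cube (R : realType) (d : nat) :
  uniform_cube R d (@pos_cube R d) = 1%E.
Proof.
rewrite (@uniform_cube_box R d (fun=> [set` `]0, 1] ])); last first.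
  by move=> i; exact: measurable_itv.
by rewrite big1// => i _; rewrite (@uniform_prob_itv R false false)// subr0.
Qed.

(** The complement of [pos_cube] is null, so bounds that break down at a zero coordinate still
    compare integrals. *)
Lemma ge0_le_integral_uniform_cube (R : realType) (d : nat)
    (f g : vec R d -> \bar R) :
  measurable_fun setT f -> measurable_fun setT g ->
  (forall x, 0 <= f x)%E -> (forall x, 0 <= g x)%E ->
  (forall x, pos_cube x -> f x <= g x)%E ->
  (\int[uniform_cube R d]_x f x <= \int[uniform_cube R d]_x g x)%E.
Proof.
move=> mf mg f0 g0 fg; apply: ae_ge0_le_integral => //.
exists (~` @pos_cube R d); split.
- by apply: measurableC; exact: measurable_pos_cube.
- rewrite [LHS]probability_setC; last exact: measurable_pos_cube.
  by rewrite [X in (_ - X)%E]uniform_cube_pos_cube subee.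
- by move=> x /= h px; apply: h => _; exact: fg.
Qed.

(** * Bounds on binomial probabilities *)

(** This is one term in the expansion of [((1 - q) + q)^n], whose terms are all nonnegative; for
    [j > n] the coefficient is [0]. *)
Lemma binomial_term_le1 (R : realFieldType) (n j : nat) (q : R) : 0 <= q <= 1 ->
  'C(n, j)%:R * (q ^+ j * (1 - q) ^+ (n - j)) <= 1.
Proof.
move=> /andP[q0 q1]; have [jn|nj] := leqP j n; last by rewrite bin_small// mul0r.
have q1' : 0 <= 1 - q by lra.
have := exprDn (1 - q) q n; rewrite subrK expr1n => E; rewrite [leRHS]E.
have jn' : (j < n.+1)%N by [].
rewrite (bigD1 (Ordinal jn'))//= mulr_natl (mulrC (q ^+ j)) lerDl.
by rewrite sumr_ge0// => i _; rewrite mulrn_wge0// mulr_ge0// exprn_ge0.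
Qed.

(* Raising both the number of trials and the number of successes by two turns
   the binomial term into another one, up to a ratio of binomial coefficients. *)
Lemma binomial_term_le (R : realFieldType) (n j : nat) (q : R) : 0 < q <= 1 ->
  'C(n, j)%:R * (q ^+ j * (1 - q) ^+ (n - j)) <=
  (j.+2%:R / (n.+1%:R * q)) ^+ 2.
Proof.
move=> /andP[q0 q1].
have := @binomial_term_le1 R n.+2 j.+2 q; rewrite ltW//= q1 => /(_ isT).
rewrite !subSS.
have E1 := mul_bin_diag n.+2 j.+1; have E2 := mul_bin_diag n.+1 j.
move: E1 E2; rewrite /= => E1 E2.
(* Two absorption identities, [E1] and [E2], lead from [C(n, j)] to [C(n + 2, j + 2)]. *)
have E : 'C(n, j)%:R = (j.+1%:R * j.+2%:R) * 'C(n.+2, j.+2)%:R / (n.+1%:R * n.+2%:R) :> R.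
  apply/(canRL (mulfK _)); first by rewrite mulf_neq0.
  rewrite -!natrM; congr (_%:R).
  by rewrite -[RHS]mulnA -E1 mulnA (mulnC 'C(n, j)) E2 -mulnA (mulnC n.+2).
set t := (1 - q) ^+ _; move=> h.
have t0 : 0 <= t by rewrite exprn_ge0//; lra.
rewrite E expr_div_n ler_pdivlMr; last by rewrite exprn_gt0// mulr_gt0.
have c0 : 0 <= (j.+1%:R * j.+2%:R) * (n.+1%:R / n.+2%:R) :> R.
  by rewrite mulr_ge0// ?divr_ge0// mulr_ge0.
have := ler_wpM2l c0 h; rewrite mulr1 => h2.
rewrite (_ : _ * _ * (n.+1%:R * q) ^+ 2 = j.+1%:R * j.+2%:R * (n.+1%:R / n.+2%:R) *
            ('C(n.+2, j.+2)%:R * (q ^+ j.+2 * t))); last first.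
  rewrite (exprS q j.+1) (exprS q j).
  have : n.+1%:R != 0 :> R by []; have : n.+2%:R != 0 :> R by [].
  move: (n.+1%:R : R) (n.+2%:R : R) (j.+1%:R : R) (j.+2%:R : R) => A B J K B0 A0.
  by field; rewrite B0.
(* There remains [(j + 1) (j + 2) (n + 1) / (n + 2) <= (j + 2)^2]. *)
apply: le_trans h2 _.
have : n.+1%:R / n.+2%:R <= 1 :> R by rewrite ler_pdivrMr// mul1r ler_nat.
have : j.+1%:R <= j.+2%:R :> R by rewrite ler_nat.
have := ler0n R j.+1; rewrite expr2 => ? ? ?.
by rewrite -[leRHS]mulr1 ler_pM// ?mulr_ge0// ler_wpM2r.
Qed.

(** Interpolation between the bounds [y^0] and [y^2], where [y = (j + 2) / ((n + 1) q)]: if [y >= 1]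
    then [1 <= y^b], and otherwise [y^2 <= y^b]. *)
Lemma binomial_term_le_powR (R : realType) (n j : nat) (q b : R) :
  0 < q <= 1 -> 0 <= b <= 2 ->
  'C(n, j)%:R * (q ^+ j * (1 - q) ^+ (n - j)) <=
  (j.+2%:R / n.+1%:R) `^ b * q `^ (- b).
Proof.
move=> q01 /andP[b0 b2]; have /andP[q0 q1] := q01.
set x : R := j.+2%:R / n.+1%:R.
have x0 : 0 < x by rewrite divr_gt0.
have -> : x `^ b * q `^ (- b) = (x / q) `^ b.
  by rewrite powRM ?invr_ge0 ?ltW// -powR_inv1 ?ltW// -powRrM mulN1r.
have [xq|xq] := leP 1 (x / q).
  apply: (@le_trans _ _ 1); first by apply: binomial_term_le1; rewrite q1 ltW.
  by rewrite -[leLHS](powRr0 (x / q)); exact: ler_powR.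
apply: (le_trans (binomial_term_le n j q01)).
rewrite (_ : _ / (_ * _) = x / q); last first.
  by rewrite /x invfM mulrA.
rewrite -powR_mulrn; last by rewrite ltW// divr_gt0.
have xq01 : 0 < x / q <= 1 by rewrite divr_gt0//= ltW.
exact: (ger_powR xq01 b2).
Qed.

(** * The case [k < d]: the expectation tends to [0] *)

(** For each coordinate [s], some [k]-set [S] avoids [s], and passing from the product over [i != s]
    to that over [S] only drops factors at most [1]; so [kdom_prob_ge] bounds the former.
    Multiplying over all [s] uses each coordinate [d - 1] times. *)
Lemma kdom_prob_geometric_mean (R : realType) (d k : nat) (x : vec R d) :
  (0 < k < d)%N -> pos_cube x ->
  coord_prod x ^+ d.-1 <= kdom_prob R d k x ^+ d.
Proof.
move=> /andP[k0 kd] px.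
have x01 i : 0 < tnth x i <= 1 by have := px i; rewrite /= in_itv.
have x0 i : 0 < tnth x i by have /andP[] := x01 i.
have x1 i : tnth x i <= 1 by have /andP[] := x01 i.
have p0 : 0 < coord_prod x by rewrite prodr_gt0.
have pE s : coord_prod x = tnth x s * \prod_(i | i != s) tnth x i.
  by rewrite (bigD1 s).
have powE (c : R) : c ^+ d = \prod_(s < d) c by rewrite prodr_const card_ord.
have -> : coord_prod x ^+ d.-1 = \prod_s \prod_(i | i != s) tnth x i.
  (* After multiplication by the full product, each factor on the right is completed by its missing
     coordinate, and both sides are its [d]-th power. *)
  apply: (mulfI (lt0r_neq0 p0)).
  rewrite -exprS prednK; last exact: leq_ltn_trans kd.
  by rewrite powE -big_split/=; apply: eq_bigr => s _.
rewrite powE; apply: ler_prod => s _.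
rewrite prodr_ge0/=; last by move=> i _; rewrite ltW.
(* There are [C(d - 1, k)] such sets, a positive number because [k < d]. *)
have [S] : exists S, S \in
    [set A : {set 'I_d} | (A \subset [set~ s]%SET) && (#|A| == k)]%SET.
  apply/card_gt0P; rewrite cards_draws cardsC1 card_ord bin_gt0.
  by rewrite -ltnS prednK// (leq_ltn_trans _ kd).
rewrite inE => /andP[/fintype.subsetP Ss /eqP Sk].
apply: le_trans (kdom_prob_ge k0 Sk _); last first.
  by move=> i; rewrite ltW//=.
rewrite (bigID (mem S))/= -[leRHS]mulr1 ler_pM ?prodr_ge0//.
- by move=> i _; rewrite ltW.
- by move=> i _; rewrite ltW.
- rewrite le_eqVlt; apply/orP; left; apply/eqP/eq_bigl => i.
  by case: (boolP (i \in S)) => [/Ss|]; rewrite ?andbF// !inE => ->.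
- by rewrite prodr_ile1// => i _; rewrite ltW//=.
Qed.

Lemma powR_prod (R : realType) (I : finType) (x : I -> R) (a : R) :
  (forall i, 0 <= x i) -> (\prod_i x i) `^ a = \prod_i x i `^ a.
Proof.
move=> x0.
suff [] : 0 <= \prod_i x i /\ (\prod_i x i) `^ a = \prod_i x i `^ a by [].
apply: (big_ind2 (fun p q => 0 <= p /\ p `^ a = q)) => //; first by rewrite powR1.
move=> p q p' q' [p0 <-] [p0' <-]; split; first exact: mulr_ge0.
by rewrite powRM.
Qed.

(** The geometric mean bound raised to the power [- b / d]. The right-hand side separates the
    coordinates, and its exponent exceeds [-1], hence is integrable, exactly when
    [b < d / (d - 1)]. *)
Lemma kdom_prob_powRN_le (R : realType) (d k : nat) (x : vec R d) (b : R) :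
  (0 < k < d)%N -> pos_cube x -> 0 <= b ->
  0 < kdom_prob R d k x /\
  kdom_prob R d k x `^ (- b) <= \prod_i tnth x i `^ (- (b * d.-1%:R / d%:R)).
Proof.
move=> kd px b0; have := kdom_prob_geometric_mean kd px.
have d0 : (0 < d)%N by case/andP: kd => _; exact: leq_ltn_trans.
have x0 i : 0 < tnth x i by have := px i; rewrite /= in_itv/= => /andP[].
have p0 : 0 < coord_prod x by rewrite prodr_gt0.
set q := kdom_prob R d k x; have /andP[q0 _] : 0 <= q <= 1 by exact: kdom_prob_itv01.
move=> h.
have q0' : 0 < q.
  rewrite lt_neqAle q0 andbT eq_sym; apply/eqP => q00.
  by move: h; rewrite q00 expr0n gtn_eqF//= leNgt exprn_gt0.
split => //; rewrite -powR_prod; last by move=> i; exact: ltW.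
rewrite !powRN lef_pV2 ?posrE ?powR_gt0//.
have -> : coord_prod x `^ (b * d.-1%:R / d%:R) = (coord_prod x ^+ d.-1) `^ (b / d%:R).
  by rewrite -powR_mulrn ?ltW// -powRrM; congr (_ `^ _); ring.
have -> : q `^ b = (q ^+ d) `^ (b / d%:R).
  rewrite -powR_mulrn// -powRrM mulrCA mulfV ?mulr1//.
  by rewrite pnatr_eq0 -lt0n.
by apply: ge0_ler_powR => //; rewrite ?nnegrE ?exprn_ge0 ?divr_ge0// (ltW p0).
Qed.

(** The interpolated binomial bound is integrated, with [F^(-b)] replaced by a product of [d]
    one-variable functions, each of integral at most [1 / (1 - a)]. Here [n] counts the other
    points, so that there are [n + 1] in all. *)
Lemma expected_kdominated_le (R : realType) (d k n j : nat) (b : R) :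
  (0 < k < d)%N -> 0 <= b <= 2 -> b * d.-1%:R / d%:R < 1 ->
  ((n.+1 * 'C(n, j))%:R%:E *
   \int[uniform_cube R d]_x ((kdom_prob R d k x) ^+ j *
     (1 - kdom_prob R d k x) ^+ (n - j))%:E <=
   (n.+1%:R * (j.+2%:R / n.+1%:R) `^ b *
     (1 - b * d.-1%:R / d%:R)^-1 ^+ d)%:E)%E.
Proof.
move=> kd b02 a1; have /andP[b0 b2] := b02.
set a := b * d.-1%:R / d%:R in a1 *; set F := kdom_prob R d k.
have a0 : 0 <= a by rewrite divr_ge0// mulr_ge0.
have F01 x : 0 <= F x <= 1 by exact: kdom_prob_itv01.
have F0 x : 0 <= F x by have /andP[] := F01 x.
have F1 x : 0 <= 1 - F x by have /andP[] := F01 x; lra.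
have mF : measurable_fun setT F by exact: measurable_kdom_prob.
have mfun : measurable_fun setT (fun x => (F x ^+ j * (1 - F x) ^+ (n - j))%:E).
  apply/measurable_EFinP; apply: measurable_funM; first exact: measurable_funX.
  by apply: measurable_funX; exact: measurable_funB.
have mprod : measurable_fun setT (fun x : vec R d => \prod_i tnth x i `^ (- a)).
  apply: measurable_prod => i _.
  exact: (measurableT_comp (@measurable_powR R (- a)) (measurable_tnth i)).
rewrite natrM EFinM -muleA EFinM EFinM -muleA lee_wpmul2l ?lee_fin//.
rewrite -ge0_integralZl//; last by move=> x _; rewrite lee_fin mulr_ge0// exprn_ge0.
apply: (@le_trans _ _ (\int[uniform_cube R d]_x
    (((j.+2%:R / n.+1%:R) `^ b)%:E * (\prod_i tnth x i `^ (- a))%:E))%E).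
  apply: ge0_le_integral_uniform_cube.
  - by apply: emeasurable_funM => //; exact: measurable_cst.
  - apply: emeasurable_funM; first exact: measurable_cst.
    exact/measurable_EFinP.
  - by move=> x; rewrite -EFinM lee_fin !mulr_ge0// exprn_ge0.
  - move=> x; rewrite -EFinM lee_fin mulr_ge0 ?powR_ge0//.
    by rewrite prodr_ge0// => i _; exact: powR_ge0.
  move=> x px; rewrite -!EFinM lee_fin.
  have [q0 hq] := kdom_prob_powRN_le kd px b0.
  apply: le_trans (binomial_term_le_powR n j _ b02) _.
    by rewrite q0/=; have /andP[] := F01 x.
  by rewrite ler_wpM2l ?powR_ge0.
rewrite ge0_integralZl; first last.
- by rewrite lee_fin powR_ge0.
- by move=> x _; rewrite lee_fin prodr_ge0// => i _; exact: powR_ge0.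
- exact/measurable_EFinP.
- by [].
rewrite lee_wpmul2l ?lee_fin ?powR_ge0//.
apply: (@integral_uniform_cube_prod_le R (fun u => u `^ (- a))).
- exact: measurable_powR.
- by move=> u; exact: powR_ge0.
- by apply: integral_uniform_powRN; rewrite a0.
Qed.

(** For [n >= 1] powers increase with the exponent, so [eps] may be lowered: to at most [1 / 2] when
    [k < d], and to [0] when [k = d]. *)
Lemma littleo_powR_le (R : realType) (d : nat) (eps e : R) (j : nat -> nat) :
  e <= eps ->
  (fun n : nat => (j n)%:R : R) =o_\oo
    (fun n : nat => n%:R `^ ((1 - eps) / d%:R) : R) ->
  \forall n \near \oo, (j n)%:R <= n%:R `^ ((1 - e) / d%:R) :> R.
Proof.
move=> ee /eqoP/(_ 1 ltr01); rewrite nearE => h.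
near=> n.
have n1 : 1 <= n%:R :> R by rewrite ler1n; near: n; exact: nbhs_infty_gt.
apply: (@le_trans _ _ (n%:R `^ ((1 - eps) / d%:R))).
  have : `|(j n)%:R : R| <= 1 * `|n%:R `^ ((1 - eps) / d%:R) : R|.
    by near: n; exact: h.
  by rewrite mul1r !ger0_norm// powR_ge0.
by apply: ler_powR => //; rewrite ler_wpM2r ?invr_ge0//; lra.
Unshelve. all: by end_near. Qed.

Lemma cvg_powRN_natr (R : realType) (a : R) : 0 < a ->
  (n%:R : R) `^ (- a) @[n --> \oo] --> (0 : R).
Proof.
move=> a0; apply/cvgr0Pnorm_le => e e0; near=> n.
have nM : (e^-1) `^ (a^-1) + 1 <= n%:R :> R.
  by near: n; exact: nbhs_infty_ger.
have n0 : 0 < n%:R :> R by apply: lt_le_trans nM; rewrite ltr_wpDl ?powR_ge0.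
rewrite ger0_norm ?powR_ge0// powRN -[leRHS]invrK lef_pV2 ?posrE ?invr_gt0 ?powR_gt0//.
have -> : e^-1 = ((e^-1) `^ (a^-1)) `^ a.
  by rewrite -powRrM mulVf ?gt_eqF// powRr1// invr_ge0 ltW.
apply: ge0_ler_powR; rewrite ?nnegrE ?powR_ge0//; first exact: ltW.
by apply: le_trans nM; rewrite lerDl.
Unshelve. all: by end_near. Qed.

Lemma cvg_expected_kdominated0 (R : realType) (d k : nat) (eps : R) (j : nat -> nat) :
  (0 < k < d)%N -> 0 < eps ->
  (fun n : nat => (j n)%:R : R) =o_\oo
    (fun n : nat => n%:R `^ ((1 - eps) / d%:R) : R) ->
  ((n * 'C(n.-1, j n))%:R%:E *
   \int[uniform_cube R d]_x ((kdom_prob R d k x) ^+ j n *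
     (1 - kdom_prob R d k x) ^+ (n.-1 - j n))%:E)%E @[n --> \oo] --> 0%E.
Proof.
move=> kd eps0 jo; have /andP[k0 kd'] := kd.
have d2 : (2 <= d)%N by exact: leq_ltn_trans kd'.
(* The cap [1 / 2] keeps [al] nonnegative, so that [n^al >= 1] absorbs the [2] of [j + 2]. *)
pose e : R := Num.min eps (1 / 2).
have e0 : 0 < e by rewrite lt_min eps0/=; lra.
have e2 : e <= 1 / 2 by rewrite ge_min lexx orbT.
have ee : e <= eps by rewrite ge_min lexx.
have jle := littleo_powR_le ee jo.
set al := (1 - e) / d%:R in jle.
have dE : d%:R = d.-1%:R + 1 :> R by rewrite natr1 prednK// ltnW.
pose D : R := d.-1%:R.
have D1 : 1 <= D by rewrite /D ler1n -ltnS prednK// ltnW.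
(* [b] lies strictly between [1 / (1 - al)] and [d / (d - 1)]. *)
pose b := d%:R / (D + e / 2).
have b0 : 0 <= b by rewrite /b divr_ge0//; lra.
have b2 : b <= 2 by rewrite /b dE -/D ler_pdivrMr; lra.
have aE : b * d.-1%:R / d%:R = D / (D + e / 2).
  by rewrite /b -/D; field; rewrite dE -/D; apply/andP; split; apply/eqP; lra.
have a1 : b * d.-1%:R / d%:R < 1 by rewrite aE ltr_pdivrMr; lra.
(* The [3] comes from [j + 2 <= 3 n^al], and [- del] is the exponent [1 - b + al b] of [n] in the
   resulting bound. *)
pose K : R := 3 `^ b * (1 - b * d.-1%:R / d%:R)^-1 ^+ d.
pose del : R := e / 2 / (D + e / 2).
have del0 : 0 < del by rewrite /del !divr_gt0//; lra.
have delE : 1 - b + al * b = - del.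
  rewrite /del /al /b dE -/D; field; apply/andP; split; apply/eqP; lra.
have key n : (0 < n)%N -> (j n)%:R <= n%:R `^ al :> R ->
  (0 <= (n * 'C(n.-1, j n))%:R%:E *
   \int[uniform_cube R d]_x ((kdom_prob R d k x) ^+ j n *
     (1 - kdom_prob R d k x) ^+ (n.-1 - j n))%:E <=
   (K * n%:R `^ (- del))%:E)%E.
  move=> n0 jn.
  apply/andP; split.
    apply: mule_ge0; first by rewrite lee_fin.
    apply: integral_ge0 => x _; have /andP[h1 h2] := kdom_prob_itv01 k x.
    by rewrite lee_fin mulr_ge0// exprn_ge0// subr_ge0.
  case: n n0 jn => // n _ jn.
  have b02 : 0 <= b <= 2 by rewrite b0.
  apply: le_trans (expected_kdominated_le n (j n.+1) kd b02 a1) _.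
  rewrite lee_fin /K [leRHS]mulrAC ler_wpM2r//.
    by rewrite exprn_ge0// invr_ge0; lra.
  have n1 : 1 <= n.+1%:R :> R by rewrite ler1n.
  have al0 : 0 <= al by rewrite /al divr_ge0//; lra.
  have j3 : (j n.+1).+2%:R <= 3 * n.+1%:R `^ al :> R.
    have : 1 <= n.+1%:R `^ al :> R by rewrite -[leLHS](powRr0 n.+1%:R); exact: ler_powR.
    rewrite -addn2 natrD; lra.
  apply: (@le_trans _ _ (n.+1%:R * (3 * n.+1%:R `^ al / n.+1%:R) `^ b)).
    rewrite ler_wpM2l//; apply: ge0_ler_powR;
      rewrite ?nnegrE ?divr_ge0 ?mulr_ge0 ?powR_ge0//.
      by lra.
    by rewrite ler_wpM2r// invr_ge0.
  rewrite -mulrA powRM// ?divr_ge0 ?powR_ge0// mulrCA ler_wpM2l ?powR_ge0//.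
  rewrite powRM ?powR_ge0 ?invr_ge0// -powRrM -powR_inv1// -powRrM mulN1r.
  rewrite -{1}(@powRr1 _ n.+1%:R)// -!powRD; first last.
  - by apply/implyP => _.
  - by apply/implyP => _.
  by rewrite -delE le_eqVlt; apply/orP; left; apply/eqP; congr (_ `^ _); lra.
apply: (@squeeze_cvge _ _ _ _ (cst 0%E) _ (fun n => (K * n%:R `^ (- del))%:E)).
- near=> n; apply: key; near: n; [exact: nbhs_infty_gt|exact: jle].
- exact: cvg_cst.
- apply: cvg_EFin; first exact: nearW.
  rewrite -(mulr0 K); apply: cvgM; first exact: cvg_cst.
  exact: cvg_powRN_natr.
Unshelve. all: by end_near. Qed.

(** * The case [k = d]: beta integrals along the first coordinate *)

(* On ]c, 1] the weight v / c exceeds 1, so the mass of the beta density beyond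
   c is controlled by its first moment. *)
Lemma integral_XMonemX_scale_ge (R : realType) (a b : nat) (c : R) :
  0 < c <= 1 ->
  (((beta_fun a.+1 b.+1 - c^-1 * beta_fun a.+2 b.+1) / c)%:E <=
   \int[@lebesgue_measure R]_(u in `[0%R, 1%R]) (XMonemX a b (u * c))%:E)%E.
Proof.
move=> /andP[c0 c1].
have G0 a' (v : R) : `[0, 1]%classic v -> (0 <= (XMonemX a' b v)%:E)%E.
  by move=> v01; rewrite lee_fin XMonemX_ge0.
have mG a' A : measurable_fun A (fun v : R => (XMonemX a' b v)%:E).
  by apply/measurable_EFinP; exact: measurable_XMonemX.
have betaE a' : (beta_fun a'.+1 b.+1 : R)%:E =
    (\int[@lebesgue_measure R]_(v in `[0%R, 1%R]) (XMonemX a' b v)%:E)%E.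
  by rewrite EFin_beta_fun/= integral_XMonemX_restrict setTI.
have sub : [set` `[0, c] ] `<=` [set` `[(0 : R), 1] ].
  by move=> v; rewrite /= !in_itv/= => /andP[-> vc]; rewrite (le_trans vc).
(* The substitution [v = u * c], source of the division by [c] in the claim. *)
have scaleE : (\int[@lebesgue_measure R]_(v in `[0%R, c]) (XMonemX a b v)%:E =
    (\int[@lebesgue_measure R]_(u in `[0%R, 1%R]) (XMonemX a b (u * c))%:E) * c%:E)%E.
  have derM : (( *%R^~ c)^`())%classic = cst c.
    by apply/funext => z; rewrite derive1Mr// derive1_id mul1r.
  have := @integration_by_substitution_increasing R (fun t => t * c)
    (XMonemX a b) _ _ ler01.
  rewrite mul0r mul1r => ->//=; last 6 first.
  - by move=> x y _ _ xy; rewrite ltr_pM2r.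
  - by rewrite derM => z _; exact: cvg_cst.
  - by rewrite derM; exact: is_cvg_cst.
  - by rewrite derM; exact: is_cvg_cst.
  - split => //.
    + by apply: cvg_at_right_filter; apply: cvgM => //; exact: cvg_cst.
    + by apply: cvg_at_left_filter; apply: cvgM => //; exact: cvg_cst.
  - exact: within_continuous_XMonemX.
  rewrite derM; under eq_integral do rewrite fctE/= EFinM.
  rewrite ge0_integralZr ?lee_fin ?ltW//.
  - apply/measurable_EFinP; apply: measurable_funTS.
    apply: (@measurableT_comp _ _ _ (measurableTypeR R) (measurableTypeR R)
      (measurableTypeR R) (XMonemX a b)); first exact: measurable_XMonemX.
    exact: measurable_funM.
  - move=> u; rewrite /= in_itv/= => /andP[u0 u1]; apply: G0.
    by rewrite /= in_itv/= mulr_ge0 ?(ltW c0)//= mulr_ile1// ltW.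
(* After multiplication by [c], the claim bounds the full beta integral by its part on [[0, c]] plus
   a first-moment term for the rest. *)
suff h : ((beta_fun a.+1 b.+1)%:E <=
    \int[@lebesgue_measure R]_(v in `[0%R, c]) (XMonemX a b v)%:E +
    (c^-1 * beta_fun a.+2 b.+1)%:E)%E.
  rewrite EFinM lee_pdivrMr// -scaleE EFinB leeBlDr//.
apply: (@le_trans _ _ (\int[@lebesgue_measure R]_(v in `[0%R, 1%R])
   ((((fun v : R => (XMonemX a b v)%:E) \_ `[0%R, c]) v) +
     c^-1%:E * (XMonemX a.+1 b v)%:E))%E).
  rewrite betaE; apply: ge0_le_integral => //.
  - exact: G0.
  - exact: mG.
  - apply: emeasurable_funD.
      by apply/measurable_restrict => //; exact: mG.
    by apply: emeasurable_funM => //; exact: mG.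
  - move=> v v01.
    have h0 : (0 <= c^-1%:E * (XMonemX a.+1 b v)%:E)%E.
      by rewrite mule_ge0 ?G0// lee_fin invr_ge0 ltW.
    rewrite patchE; case: ifPn; first by rewrite leeDl.
    rewrite notin_setE/= in_itv/= add0e => /negP.
    move: v01; rewrite /= in_itv/= => /andP[v0 v1]; rewrite v0/= -ltNge => cv.
    rewrite -EFinM lee_fin /XMonemX exprS -mulrA mulrA.
    rewrite ler_peMl ?mulr_ge0 ?exprn_ge0// ?subr_ge0//.
    by rewrite mulrC ler_pdivlMr// mul1r ltW.
rewrite ge0_integralD//; first last.
- by apply: emeasurable_funM => //; exact: mG.
- by move=> v v01; rewrite mule_ge0 ?G0// lee_fin invr_ge0 ltW.
- by apply/measurable_restrict => //; exact: mG.
- by move=> v v01; rewrite patchE; case: ifPn => // _; exact: G0.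
rewrite -integral_mkcondr setIidr// ge0_integralZl//; first last.
- by rewrite lee_fin invr_ge0 ltW.
- exact: G0.
- exact: mG.
by rewrite EFinM betaE.
Qed.

(** [(n + 1) C(n, j)] normalises the beta density with parameters [j + 1] and [n - j + 1]; the
    second identity computes the mean of that law. *)
Lemma beta_fun_binomial (R : realType) (n j : nat) : (j <= n)%N ->
  (n.+1 * 'C(n, j))%:R * beta_fun j.+1 (n - j).+1 = 1 :> R /\
  (n.+1 * 'C(n, j))%:R * beta_fun j.+2 (n - j).+1 = j.+1%:R / n.+2%:R :> R.
Proof.
move=> jn; rewrite !beta_fun_fact addSn subnKC//.
have E : ((n.+1 * 'C(n, j)) * (j`! * (n - j)`!))%N = n.+1`!.
  by rewrite -mulnA bin_fact// factS.
have f0 m : m`!%:R != 0 :> R by rewrite pnatr_eq0 -lt0n fact_gt0.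
split; rewrite mulrA -natrM; first by rewrite E divff.
rewrite (factS j) -[(j.+1 * _ * _)%N]mulnA mulnCA E (factS n.+1).
rewrite (natrM _ j.+1 n.+1`!) (natrM _ n.+2 n.+1`!).
move: (n.+1`!%:R : R) (f0 n.+1) => f fn0.
have : n.+2%:R != 0 :> R by [].
move: (n.+2%:R : R) => m mn0.
by field; rewrite fn0 mn0.
Qed.

(** Along the first coordinate the domination probability is [u * c], with [c] the product of the
    others. The integral is thus [1 / c] times the probability that a beta variable is at most [c],
    which Markov's inequality bounds below by [1] minus the mean over [c]. *)
Lemma integral_first_coordinate_ge (R : realType) (d n j : nat) (t : vec R d) :
  (j <= n)%N -> pos_cube t ->
  (((coord_prod t)^-1 * (1 - (coord_prod t)^-1 * (j.+1%:R / n.+2%:R)))%:E <=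
   \int[uniform_prob (@ltr01 R)]_u ((n.+1 * 'C(n, j))%:R%:E *
     (kdom_prob R d.+1 d.+1 (cons_vec (u, t)) ^+ j *
     (1 - kdom_prob R d.+1 d.+1 (cons_vec (u, t))) ^+ (n - j))%:E))%E.
Proof.
move=> jn pt; set F := kdom_prob R d.+1 d.+1; set c := coord_prod t.
have t01 i : 0 < tnth t i <= 1 by have := pt i; rewrite /= in_itv.
have c0 : 0 < c by rewrite prodr_gt0// => i _; have /andP[] := t01 i.
have c1 : c <= 1.
  by rewrite prodr_ile1// => i _; have /andP[/ltW -> ->] := t01 i.
have F01 x : 0 <= F x <= 1 by exact: kdom_prob_itv01.
have F0 x : 0 <= F x by have /andP[] := F01 x.
have F1 x : 0 <= 1 - F x by have /andP[] := F01 x; lra.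
have mc : measurable_fun setT (fun u : measurableTypeR R => cons_vec (u, t)).
  exact: (measurableT_comp (@measurable_cons_vec R d) (pair2_measurable t)).
have mF : measurable_fun setT (fun u : measurableTypeR R => F (cons_vec (u, t))).
  exact: (measurableT_comp (@measurable_kdom_prob R d.+1 d.+1) mc).
have mfun : measurable_fun setT (fun u : measurableTypeR R =>
    (F (cons_vec (u, t)) ^+ j * (1 - F (cons_vec (u, t))) ^+ (n - j))%:E).
  apply/measurable_EFinP; apply: measurable_funM; first exact: measurable_funX.
  by apply: measurable_funX; exact: measurable_funB.
have f0 u : (0 <= (F (cons_vec (u, t)) ^+ j * (1 - F (cons_vec (u, t))) ^+ (n - j))%:E)%E.
  by rewrite lee_fin mulr_ge0// exprn_ge0.
rewrite ge0_integralZl//.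
rewrite integral_uniform// subr0 invr1 mul1e.
rewrite (eq_integral (fun u : measurableTypeR R =>
  (XMonemX j (n - j) (u * c))%:E)); last first.
  move=> u; rewrite inE/= in_itv/= => u01.
  suff -> : F (cons_vec (u, t)) = u * c by [].
  rewrite /F kdom_prob_full//.
    rewrite big_ord_recl; congr (_ * _).
    by apply: eq_bigr => i _; rewrite /cons_vec/= tnthS.
  move=> i; have [->//|i0] := eqVneq i ord0.
  case: (unliftP ord0 i) i0 => [i' -> _|->]; last by rewrite eqxx.
  by rewrite /cons_vec/= tnthS; have /andP[/ltW -> ->] := t01 i'.
have c01 : 0 < c <= 1 by rewrite c0.
apply: le_trans (lee_wpmul2l _ (integral_XMonemX_scale_ge j (n - j) c01)); last first.
  by rewrite lee_fin.
have [B1 B2] := beta_fun_binomial R jn.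
rewrite -EFinM lee_fin [leRHS]mulrA [in leRHS]mulrBr B1 [in leRHS](mulrCA _ c^-1) B2.
by rewrite (mulrC c^-1).
Qed.

(** * The case [k = d]: dyadic boxes and divergence *)

(** Disjoint regions that witness the divergence of the integral of [1 / c]: as [m] grows, the
    volume is halved while the lower bound [2^m] on [1 / c] doubles. *)
Definition dyadic_box (R : realType) (d m : nat) : set (vec R d.+1) :=
  [set t | forall i, (if i == ord0 then `](2^-1) ^+ m.+1, (2^-1) ^+ m]
                      else `]2^-1, 1])%classic (tnth t i)].

Lemma measurable_dyadic_box (R : realType) (d m : nat) :
  measurable (@dyadic_box R d m).
Proof.
apply: (@measurable_box R d.+1 (fun i => (if i == ord0 then
  `](2^-1) ^+ m.+1, (2^-1) ^+ m] else `]2^-1, 1])%classic)).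
by move=> i; case: ifP => _; exact: measurable_itv.
Qed.

Lemma uniform_cube_dyadic_box (R : realType) (d m : nat) :
  uniform_cube R d.+1 (@dyadic_box R d m) = ((2^-1) ^+ (m.+1 + d))%:E.
Proof.
have h1 : (2^-1 : R) ^+ m <= 1 by rewrite exprn_ile1//; lra.
have h0 : 0 <= (2^-1 : R) ^+ m by rewrite exprn_ge0//; lra.
rewrite (@uniform_cube_box R d.+1 (fun i => (if i == ord0 then
  `](2^-1) ^+ m.+1, (2^-1) ^+ m] else `]2^-1, 1])%classic)); last first.
  by move=> i; case: ifP => _; exact: measurable_itv.
rewrite big_ord_recl/= exprD EFinM; congr (_ * _)%E.
  have h2 : 0 <= (2^-1 : R) ^+ m.+1 by rewrite exprn_ge0//; lra.
  have h3 : (2^-1 : R) ^+ m.+1 <= (2^-1) ^+ m by rewrite exprS; lra.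
  by rewrite uniform_prob_itv//; congr EFin; rewrite exprS; lra.
rewrite (eq_bigr (fun=> (2^-1)%:E)); last first.
  have h2 : (2^-1 : R) <= 1 by lra.
  by move=> i _; rewrite uniform_prob_itv//; congr EFin; lra.
by rewrite prodEFin prodr_const card_ord.
Qed.

(** The upper bound on the product makes [1 / c] large; the lower bound keeps [c] above the beta
    mean, so that Markov's inequality is effective. *)
Lemma dyadic_boxP (R : realType) (d m : nat) (t : vec R d.+1) : dyadic_box m t ->
  pos_cube t /\ (2^-1) ^+ (m.+1 + d) <= coord_prod t <= (2^-1) ^+ m.
Proof.
move=> h.
have h1 : (2^-1 : R) ^+ m <= 1 by rewrite exprn_ile1//; lra.
have t0 : (2^-1) ^+ m.+1 < tnth t ord0 <= (2^-1) ^+ m.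
  by have := h ord0; rewrite /= in_itv.
have tS i : 2^-1 < tnth t (lift ord0 i) <= 1.
  by have := h (lift ord0 i); rewrite /= in_itv.
have t01 i : 0 < tnth t i <= 1.
  case: (unliftP ord0 i) => [i' ->|->].
    by have /andP[a ->] := tS i'; rewrite andbT; apply: lt_trans a; lra.
  have /andP[a b] := t0; apply/andP; split; last exact: le_trans b h1.
  by apply: lt_trans a; rewrite exprn_gt0//; lra.
split; first by move=> i; rewrite /= in_itv/= t01.
have /andP[a b] := t0.
have p0 : 0 <= (2^-1 : R) ^+ m.+1 by rewrite exprn_ge0//; lra.
have q0 : 0 <= (2^-1 : R) ^+ d by rewrite exprn_ge0//; lra.
rewrite big_ord_recl exprD; apply/andP; split.
  apply: ler_pM => //; first exact: ltW.
  have -> : (2^-1 : R) ^+ d = \prod_(i < d) 2^-1 by rewrite prodr_const card_ord.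
  by apply: ler_prod => i _; have /andP[/ltW ->] := tS i; rewrite andbT; lra.
rewrite -[leRHS]mulr1 ler_pM//.
- by have /andP[/ltW ->] := t01 ord0.
- by rewrite prodr_ge0// => i _; have /andP[/ltW ->] := t01 (lift ord0 i).
- by rewrite prodr_ile1// => i _; have /andP[/ltW -> ->] := t01 (lift ord0 i).
Qed.

Lemma dyadic_box_inj (R : realType) (d m m' : nat) (t : vec R d.+1) :
  dyadic_box m t -> dyadic_box m' t -> m = m'.
Proof.
wlog mm : m m' / (m < m')%N => [hw h h'|h h'].
  have [mm|mm|//] := ltngtP m m'; [exact: (hw _ _ mm h h')|exact/esym/(hw _ _ mm h' h)].
have := h ord0; have := h' ord0; rewrite /= !in_itv/=.
move=> /andP[_ a] /andP[b _]; have := lt_le_trans b a.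
by rewrite ltNge ler_wiXn2l//; lra.
Qed.

(** Each of the first [M] boxes contributes at least [2^m / 2] times its volume [2^-(m + 1 + d)],
    that is [2^-(d + 2)] whatever [m] is. *)
Lemma expected_dominated_ge (R : realType) (d n j M : nat) : (j <= n)%N ->
  j.+1%:R / n.+2%:R * 2 ^+ (M + d) <= 2^-1 :> R ->
  ((M%:R * (2^-1) ^+ d.+2)%:E <= (n.+1 * 'C(n, j))%:R%:E *
   \int[uniform_cube R d.+2]_x ((kdom_prob R d.+2 d.+2 x) ^+ j *
     (1 - kdom_prob R d.+2 d.+2 x) ^+ (n - j))%:E)%E.
Proof.
move=> jn small; set F := kdom_prob R d.+2 d.+2; set C := (n.+1 * _)%:R.
have C0 : 0 <= C by rewrite ler0n.
have F01 x : 0 <= F x <= 1 by exact: kdom_prob_itv01.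
have F0 x : 0 <= F x by have /andP[] := F01 x.
have F1 x : 0 <= 1 - F x by have /andP[] := F01 x; lra.
have mF : measurable_fun setT F by exact: measurable_kdom_prob.
have mfun : measurable_fun setT (fun x => (F x ^+ j * (1 - F x) ^+ (n - j))%:E).
  apply/measurable_EFinP; apply: measurable_funM; first exact: measurable_funX.
  by apply: measurable_funX; exact: measurable_funB.
pose f x := (C%:E * (F x ^+ j * (1 - F x) ^+ (n - j))%:E)%E.
have f0 x : (0 <= f x)%E.
  by rewrite mule_ge0// lee_fin// mulr_ge0// exprn_ge0.
have mf : measurable_fun setT f by apply: emeasurable_funM => //; exact: measurable_cst.
rewrite -ge0_integralZl//; last by move=> x _; rewrite lee_fin mulr_ge0// exprn_ge0.
rewrite (ge0_integral_uniform_cubeS mf f0).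
(* The factor [2^m] bounds [1 / c] on the box, and [1 / 2] bounds the beta probability. *)
pose s (m : nat) (t : vec R d.+1) : \bar R :=
  ((2 ^+ m / 2)%:E * (\1_(dyadic_box m) t)%:E)%E.
have s0 m t : (0 <= s m t)%E by rewrite mule_ge0// lee_fin// divr_ge0// exprn_ge0.
have ms m : measurable_fun setT (s m).
  apply: emeasurable_funM; first exact: measurable_cst.
  by apply/measurable_EFinP; apply: measurable_indic; exact: measurable_dyadic_box.
apply: (@le_trans _ _ (\int[uniform_cube R d.+1]_t \sum_(m <- iota 0 M) s m t)%E).
  rewrite ge0_integral_sum//.
  rewrite (eq_bigr (fun=> ((2^-1) ^+ d.+2)%:E)); last first.
    move=> m _; rewrite ge0_integralZl; first last.
    - by rewrite lee_fin divr_ge0// exprn_ge0.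
    - by move=> t _; rewrite lee_fin.
    - by apply/measurable_EFinP; apply: measurable_indic; exact: measurable_dyadic_box.
    - by [].
    rewrite integral_indic//; last exact: measurable_dyadic_box.
    rewrite setIT [X in (_ * X)%E]uniform_cube_dyadic_box -EFinM; congr EFin.
    rewrite addSnnS exprD mulrACA -exprMn divff// expr1n mul1r.
    by rewrite [in RHS]exprS.
  rewrite sumEFin lee_fin big_const_seq count_predT size_iota iter_addr_0.
  by rewrite mulr_natl.
apply: ge0_le_integral => //.
- by move=> t _; rewrite sume_ge0.
- by apply: emeasurable_sum => m; exact: ms.
- apply: (@measurable_fun_fubini_tonelli_G _ _ _ _ _ (uniform_prob (@ltr01 R))
    (f \o @cons_vec R d.+1)).
    by apply: (measurableT_comp mf); exact: measurable_cons_vec.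
  by move=> x; exact: f0.
move=> t _.
have g0 : (0 <= \int[uniform_prob (@ltr01 R)]_u f (cons_vec (u, t)))%E.
  by apply: integral_ge0 => u _; exact: f0.
have [[m mM tm]|h] := pselect (exists2 m, (m < M)%N & dyadic_box m t); last first.
  rewrite big_seq big1// => m; rewrite mem_iota/= add0n => mM.
  rewrite /s indicE memNset ?mule0// => tm; by apply: h; exists m.
(* The boxes are disjoint, so only the term of the box containing [t] survives. *)
rewrite (bigD1_seq m)/= ?mem_iota ?iota_uniq//= big1 ?adde0; last first.
  move=> m' m'm; rewrite /s indicE memNset ?mule0// => tm'.
  by rewrite (dyadic_box_inj tm tm') eqxx in m'm.
have [pt /andP[c1 c2]] := dyadic_boxP tm.
apply: le_trans (integral_first_coordinate_ge jn pt).
rewrite /s indicE mem_set// mule1 lee_fin.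
set c := coord_prod t in c1 c2 *.
have p2 p : (2^-1 : R) ^+ p = (2 ^+ p)^-1 by rewrite exprVn.
have cpos : 0 < c by apply: lt_le_trans c1; rewrite p2 invr_gt0 exprn_gt0.
apply: ler_pM; rewrite ?invr_ge0 ?exprn_ge0//.
  by rewrite -[leLHS]invrK lef_pV2 ?posrE ?invr_gt0 ?exprn_gt0// -p2.
(* Since [m + 1 <= M], one bound serves all the boxes; with [small] it puts the beta mean below
   [c / 2]. *)
have ci : c^-1 <= 2 ^+ (M + d).
  rewrite -[leRHS]invrK lef_pV2 ?posrE ?invr_gt0 ?exprn_gt0//.
  apply: le_trans c1; rewrite -p2 ler_wiXn2l//; try lra.
  by rewrite leq_add2r.
have r0 : 0 <= j.+1%:R / n.+2%:R :> R by rewrite divr_ge0.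
have h := ler_wpM2r r0 ci; rewrite mulrC in small.
have := le_trans h small; move: (c^-1 * _) => y; lra.
Qed.

(** Since [j] is at most of order [n^(1 / 2)], the beta mean tends to [0], and any fixed number [M]
    of boxes is eventually admissible. *)
Lemma cvg_expected_dominatedy (R : realType) (d : nat) (eps : R) (j : nat -> nat) :
  (2 <= d)%N -> 0 < eps ->
  (fun n : nat => (j n)%:R : R) =o_\oo
    (fun n : nat => n%:R `^ ((1 - eps) / d%:R) : R) ->
  ((n * 'C(n.-1, j n))%:R%:E *
   \int[uniform_cube R d]_x ((kdom_prob R d d x) ^+ j n *
     (1 - kdom_prob R d d x) ^+ (n.-1 - j n))%:E)%E @[n --> \oo] --> +oo%E.
Proof.
case: d => [//|[//|d]] _ eps0 jo.
(* With [e = 0] this reads [j <= n^(1 / d.+2)], the dimension now being [d.+2]; hence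
   [j <= n^(1 / 2)]. *)
have jle := littleo_powR_le (ltW eps0) jo.
have h0 := @cvg_powRN_natr R (1 / 2) ltac:(lra).
(* In the divisor [4], one factor [2] absorbs that of [j + 1 <= 2 n^(1 / 2)], the other yields the
   [2^-1] required by [expected_dominated_ge]. *)
have key M n : (0 < n)%N ->
    (j n)%:R <= n%:R `^ ((1 - 0) / d.+2%:R) :> R ->
    `|n%:R `^ (- (1 / 2)) : R| <= (2 ^+ (M + d))^-1 / 4 ->
    ((M%:R * (2^-1) ^+ d.+2)%:E <= (n * 'C(n.-1, j n))%:R%:E *
   \int[uniform_cube R d.+2]_x ((kdom_prob R d.+2 d.+2 x) ^+ j n *
     (1 - kdom_prob R d.+2 d.+2 x) ^+ (n.-1 - j n))%:E)%E.
  case: n => // n _ jn; rewrite ger0_norm ?powR_ge0// => small.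
  have n1 : 1 <= n.+1%:R :> R by rewrite ler1n.
  have p2 : 1 <= 2 ^+ (M + d) :> R by rewrite exprn_ege1//; lra.
  have sq : n.+1%:R `^ (1 / 2) = n.+1%:R * n.+1%:R `^ (- (1 / 2)) :> R.
    rewrite -{2}(@powRr1 _ n.+1%:R)// -powRD; last by apply/implyP.
    by congr (_ `^ _); lra.
  have s1 : 1 <= n.+1%:R `^ (1 / 2) :> R.
    by rewrite -[leLHS](powRr0 n.+1%:R); apply: ler_powR => //; lra.
  have j1 : (j n.+1).+1%:R <= 2 * n.+1%:R `^ (1 / 2) :> R.
    have : (j n.+1)%:R <= n.+1%:R `^ (1 / 2) :> R.
      apply: le_trans jn _; apply: ler_powR => //.
      rewrite subr0 !mul1r lef_pV2 ?posrE// ler_nat//.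
    rewrite -(natr1 (j n.+1)).
    by move: (n.+1%:R `^ (1 / 2)) s1 => y; lra.
  have j2 : (j n.+1).+1%:R <= n.+1%:R * (2 ^+ (M + d))^-1 / 2 :> R.
    apply: le_trans j1 _; rewrite sq.
    have := ler_wpM2l (ler0n R n.+1) small.
    move: (n.+1%:R * n.+1%:R `^ _) => y; lra.
  (* A positive lower bound requires [j <= n], as the binomial coefficient vanishes otherwise. *)
  have jn' : (j n.+1 <= n)%N.
    rewrite -ltnS -(ler_nat R); apply: le_trans j2 _.
    rewrite -mulrA -[leRHS]mulr1 ler_wpM2l// -invfM invf_le1 ?mulr_gt0 ?exprn_gt0//.
    lra.
  apply: expected_dominated_ge => //.
  rewrite mulrAC ler_pdivrMr// -ler_pdivlMr ?exprn_gt0//.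
  apply: le_trans j2 _.
  have n2 : n.+1%:R <= n.+2%:R :> R by rewrite ler_nat.
  rewrite [leLHS]mulrAC ler_wpM2r ?invr_ge0 ?exprn_ge0//; lra.
apply/cvgeyPge => A.
have [M MA] : exists M : nat, A <= M%:R * (2^-1) ^+ d.+2.
  have p0 : 0 < (2^-1 : R) ^+ d.+2 by rewrite exprn_gt0//; lra.
  exists (Num.bound `|A / (2^-1) ^+ d.+2|).
  rewrite -ler_pdivrMr//; apply: le_trans (ler_norm _) _.
  by apply/ltW/archi_boundP.
near=> n.
apply: (@le_trans _ _ (M%:R * (2^-1) ^+ d.+2)%:E); first by rewrite lee_fin.
apply: key; near: n.
- exact: nbhs_infty_gt.
- exact: jle.
- move/cvgr0Pnorm_le : h0; apply.
  by rewrite divr_gt0// invr_gt0 exprn_gt0.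
Unshelve. all: by end_near. Qed.

Theorem theorem2 (R : realType) (d k : nat) (eps : R)
  (disp : nat -> measure_display)
  (T : forall n : nat, measurableType (disp n))
  (P : forall n : nat, probability (T n) R)
  (p : forall n : nat, 'I_n -> {RV (P n) >-> vec R d})
  (j : nat -> nat) :
  (2 <= d)%N -> (1 <= k <= d)%N -> 0 < eps ->
  (forall n : nat, mutually_independent (p n)) ->
  (forall (n : nat) (i : 'I_n), uniform_on_cube (p n i)) ->
  (fun n : nat => (j n)%:R : R) =o_\oo
    (fun n : nat => n%:R `^ ((1 - eps) / d%:R) : R) ->
  ('E_(P n)[fun w => (num_kdominated_by k (fun i => p n i w) (j n))%:R])%E
    @[n --> \oo] --> (if (k < d)%N then 0%E else +oo%E : \bar R).
Proof.
move=> d2 /andP[k1 kd] eps0 indp unifp jo.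
(* Being dominated by exactly [j] other points means having indegree [j] for the relation
   [kdominates k], and the cube law is the common law of the points. *)
have -> : (fun n => 'E_(P n)[fun w =>
    (num_kdominated_by k (fun i => p n i w) (j n))%:R])%E =
  (fun n => (n * 'C(n.-1, j n))%:R%:E *
   \int[uniform_cube R d]_x ((kdom_prob R d k x) ^+ j n *
     (1 - kdom_prob R d k x) ^+ (n.-1 - j n))%:E)%E.
  apply/funext => n.
  have := @expected_exact_indegree _ _ (T n) (vec R d) R (P n)
    (uniform_cube R d) 'I_n (p n) (@kdominates R d k) (j n) (indp n) (unifp n)
    (@measurable_kdominates R d k).
  by rewrite card_ord.
case: ifPn => [kd'|]; first by apply: (cvg_expected_kdominated0 _ eps0 jo); rewrite k1.
rewrite -leqNgt => dk; have -> : k = d by apply/eqP; rewrite eqn_leq kd.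
exact: (cvg_expected_dominatedy d2 eps0 jo).
Qed.
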